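(* Let $\Phi:\mathbb{R}\to\mathbb{R}$ be a continuous, non-decreasing function satisfying $\Phi(z)\ge 0$ for $z\ge 0$ and $\Phi(-z)=-\Phi(z)$, such that $\Phi$ is locally Lipschitz-continuous and the limit $\lim_{z\to0}\frac{\Phi(z)}{z}$ exists and is finite. Let $$F(a,b)=\frac{\Phi(a-b)}{a-b}\ \text{ for } a\neq b,\qquad F(a,a)=\lim_{z\to0}\frac{\Phi(z)}{z},$$ and let $\mu$ be the density of a Lévy measure with low singularity. Then $\rho(a,b;x,y)=F(a,b)\,\mu(|x-y|)$ is a homogeneous jump kernel.
   Context: Density of a Lévy measure with low singularity: a non-negative (Borel) function $\mu:[0,\infty)\to[0,\infty)$ with $\int_{\mathbb{R}^N}(1\wedge|y|)\,\mu(|y|)\,dy<\infty$. Homogeneous jump kernel: a function $\rho:(\mathbb{R}\times\mathbb{R})\times(\mathbb{R}^N\times\mathbb{R}^N)\to\mathbb{R}$, written $\rho(a,b;x,y)$, such that for all $a,b,c,d\in\mathbb{R}$ and almost every $(x,y)\in\mathbb{R}^N\times\mathbb{R}^N$: (A1) $\rho$ is a non-negative Borel function; (A2) $\rho(a,b;x,y)=\rho(b,a;y,x)$; (A3) $(a-b)\rho(a,b;x,y)\ge(c-d)\rho(c,d;x,y)$ whenever $a\ge c\ge d\ge b$; (A4) $\rho(a,b;x,y)=\rho(a,b;|x-y|)$, i.e. $\rho$ depends on $x,y$ only through $|x-y|$; (A5) for every $R>0$ there is a function $m_R:[0,\infty)\to[0,\infty)$ such that $\sup_{-R\le a,b\le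 R}\rho(a,b;x,y)\le m_R(|x-y|)$ and $\int_{\mathbb{R}^N}(1\wedge|y|)\,m_R(|y|)\,dy=K_R<\infty$; (A6) $\rho$ is continuous with respect to the first two variables, and for every $\varepsilon>0$ and every $R>\varepsilon$ there is a constant $C_{R,\varepsilon}$ such that $|\rho(a,b;x,y)-\rho(c,d;x,y)|\le C_{R,\varepsilon}(|a-c|+|b-d|)\,m_R(|x-y|)$ for all $a,b,c,d\in[-R,R]$ with $|a-b|\ge\varepsilon$ and $|c-d|\ge\varepsilon$. *)

(* Defs.v *)
From HB Require Import structures.
From mathcomp Require Import all_boot all_order all_algebra.
From mathcomp Require Import all_classical all_reals all_analysis.

Set Implicit Arguments.
Unset Strict Implicit.
Unset Printing Implicit Defensive.

Import Order.TTheory GRing.Theory Num.Theory.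
Import numFieldNormedType.Exports.

Local Open Scope classical_set_scope.
Local Open Scope ring_scope.

(* R^n as a measurable type: on tuples the library puts the product of the
   Borel sigma-algebras of the factors, i.e. the Borel sigma-algebra of R^n. *)
Notation Rn R n := (n.-tuple (measurableTypeR R)).

Section euclidean.
Context {R : realType} {n : nat}.
Implicit Types x y : Rn R n.

Definition enorm x : R := Num.sqrt (\sum_(i < n) (tnth x i : R) ^+ 2).

Definition subt x y : Rn R n :=
  [tuple ((tnth x i : R) - (tnth y i : R) : measurableTypeR R) | i < n].

End euclidean.

(* The canonical sigma-finiteness of product measures in the library is only
   found for products of (sub)probabilities. *)
Lemma sigma_finite_product_measure1 d1 d2 (T1 : measurableType d1)
    (T2 : measurableType d2) (R : realType)
    (m1 : {sigma_finite_measure set T1 -> \bar R})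
    (m2 : {sigma_finite_measure set T2 -> \bar R}) :
  sigma_finite setT (m1 \x m2)%E.
Proof.
have /sigma_finiteP[F [TF ndF Foo]] := sigma_finiteT m1.
have /sigma_finiteP[G [TG ndG Goo]] := sigma_finiteT m2.
exists (fun n => F n `*` G n).
  rewrite -setXTT TF TG; apply/seteqP; split => -[x y] /=.
    move=> [[n _ Fnx] [k _ Gky]]; exists (maxn n k) => //; split.
    - by move: x Fnx; exact/subsetPset/ndF/leq_maxl.
    - by move: y Gky; exact/subsetPset/ndG/leq_maxr.
  by move=> [n _ [/= ? ?]]; split; exists n.
move=> k; have [? ?] := Foo k; have [? ?] := Goo k.
split; first exact: measurableX.
by rewrite product_measure1E// lte_mul_pinfty// ge0_fin_numE.
Qed.

(* The library only has Lebesgue measure on the line. On R^(n+1) it is the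
   image of (Lebesgue on R) x (Lebesgue on R^n) under (t, y) |-> t :: y. *)
Section lebesgue_step.
Context {R : realType} {n : nat}.
Variable mu : {sigma_finite_measure set (Rn R n) -> \bar R}.

Definition consp (p : measurableTypeR R * Rn R n) : Rn R n.+1 :=
  [the n.+1.-tuple _ of p.1 :: p.2].

Lemma measurable_consp : measurable_fun setT consp.
Proof. exact: measurable_cons. Qed.

Definition lebesgue_cons : set (Rn R n.+1) -> \bar R :=
  pushforward (lebesgue_measure \x mu)%E consp.

Let lebesgue_cons0 : lebesgue_cons set0 = 0%E.
Proof. by rewrite /lebesgue_cons /pushforward preimage_set0 measure0. Qed.

Let lebesgue_cons_ge0 A : (0 <= lebesgue_cons A)%E.
Proof. by rewrite /lebesgue_cons /pushforward. Qed.

Let lebesgue_cons_sigma_additive : semi_sigma_additive lebesgue_cons.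
Proof.
move=> F mF tF mUF; rewrite /lebesgue_cons /pushforward preimage_bigcup.
have mp A : measurable A -> measurable (consp @^-1` A).
  by move=> mA; rewrite -[X in measurable X]setTI; exact: measurable_consp.
apply: measure_semi_sigma_additive => [k||]; first exact: mp.
- apply/trivIsetP => /= i j _ _ ij; rewrite -preimage_setI.
  by move/trivIsetP : tF => /(_ _ _ _ _ ij) ->//; rewrite preimage_set0.
- by rewrite -preimage_bigcup; exact: mp.
Qed.

HB.instance Definition _ := isMeasure.Build _ _ _ lebesgue_cons
  lebesgue_cons0 lebesgue_cons_ge0 lebesgue_cons_sigma_additive.

Let lebesgue_cons_sigma_finite : sigma_finite setT lebesgue_cons.
Proof.
have [F UF Foo] := sigma_finite_product_measure1 lebesgue_measure mu.
pose unconsp (y : Rn R n.+1) : measurableTypeR R * Rn R n :=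
  (thead y, [tuple of behead y]).
have consK : cancel consp unconsp.
  by move=> [t y]; congr pair; apply/val_inj.
have unconsK : cancel unconsp consp by move=> y; rewrite [RHS]tuple_eta; exact/val_inj.
have mun : measurable_fun setT unconsp.
  apply/measurable_fun_pair; last exact: measurable_behead.
  exact: measurable_tnth.
exists (fun k => unconsp @^-1` F k).
  by rewrite -preimage_bigcup -UF preimage_setT.
move=> k; have [mFk Fkoo] := Foo k; split.
  by rewrite -[X in measurable X]setTI; exact: mun.
rewrite /lebesgue_cons /pushforward.
rewrite (_ : consp @^-1` _ = F k)//.
by apply/seteqP; split => p /=; rewrite consK.
Qed.

HB.instance Definition _ := Measure_isSigmaFinite.Build _ _ _ lebesgue_cons
  lebesgue_cons_sigma_finite.

End lebesgue_step.

Section lebesgueN.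
Context {R : realType}.

Fixpoint lebesgueN (n : nat) : {sigma_finite_measure set (Rn R n) -> \bar R} :=
  if n is n'.+1 then lebesgue_cons (lebesgueN n')
  else (@dirac _ (Rn R 0) [tuple] R).

Lemma lebesgueN_box n (a b : 'I_n -> R) : (forall i, a i <= b i) ->
  lebesgueN n [set y | forall i, a i <= (tnth y i : R) <= b i] =
  (\prod_(i < n) (b i - a i))%:E.
Proof.
elim: n a b => [|n IH] a b ab.
  by rewrite big_ord0 /= diracE mem_set// => -[].
rewrite /= /lebesgue_cons /pushforward big_ord_recl EFinM.
set B := [set y : Rn R n |
  forall i, a (lift ord0 i) <= (tnth y i : R) <= b (lift ord0 i)].
have mB : measurable B.
  rewrite (_ : B = \bigcap_i ((fun y : Rn R n => tnth y i) @^-1`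
      `[a (lift ord0 i), b (lift ord0 i)]%classic)); last first.
    apply/seteqP; split => y /=.
      by move=> By i _ /=; rewrite in_itv/=; exact: By.
    by move=> By i; have := By i Logic.I; rewrite /= in_itv.
  apply: fin_bigcap_measurable => //.
  by move=> i _; rewrite -[X in measurable X]setTI; exact: measurable_tnth.
rewrite (_ : _ @^-1` _ = `[a ord0, b ord0]%classic `*` B).
  rewrite product_measure1E//; congr (_ * _)%E; last exact: IH.
  rewrite [LHS]lebesgue_measure_itv/= lte_fin.
  have := ab ord0; rewrite le_eqVlt => /predU1P[->|->//].
  by rewrite ltxx subrr.
apply/seteqP; split => -[t y] /=.
  move=> ty; split; first by have := ty ord0; rewrite in_itv.
  by move=> i; have := ty (lift ord0 i); rewrite tnthS.
rewrite in_itv/= => -[t0 By] i; have [j ->|->//] := unliftP ord0 i.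
by rewrite tnthS; exact: By.
Qed.

End lebesgueN.

Section jump_kernel.
Context {R : realType} (N : nat).

(* Functions on [0, +oo[ are functions R -> R constrained on `[0, +oo[. *)
Definition low_singularity_density (mu : R -> R) : Prop :=
  [/\ measurable_fun (`[0, +oo[%classic : set R) mu,
      forall r : R, 0 <= r -> 0 <= mu r &
      (\int[lebesgueN N]_y (Num.min 1 (enorm y) * mu (enorm y))%:E < +oo)%E].

Implicit Types (rho : R -> R -> Rn R N -> Rn R N -> R) (m : R -> R -> R).

Local Notation "'{ae2,' P }" := {ae (lebesgueN N \x lebesgueN N)%E, P}.

(* "For all a, b, c, d and almost every (x, y)" is read in that order: the null
   set may depend on a, b, c, d, except in kernel_bounded and
   kernel_continuous, where all values of (a, b) are involved at once. *)
Definition kernel_borel rho : Prop :=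
  (forall a b x y, 0 <= rho a b x y) /\
  measurable_fun setT (fun p : (R * R) * (Rn R N * Rn R N) =>
    rho p.1.1 p.1.2 p.2.1 p.2.2).

Definition kernel_symmetric rho : Prop :=
  forall a b : R, {ae2, forall xy, rho a b xy.1 xy.2 = rho b a xy.2 xy.1}.

Definition kernel_monotone rho : Prop :=
  forall a b c d : R, c <= a -> d <= c -> b <= d ->
    {ae2, forall xy,
      (c - d) * rho c d xy.1 xy.2 <= (a - b) * rho a b xy.1 xy.2}.

Definition kernel_homogeneous rho : Prop :=
  exists r : R -> R -> R -> R, forall a b : R,
    {ae2, forall xy, rho a b xy.1 xy.2 = r a b (enorm (subt xy.1 xy.2))}.

Definition kernel_bounded rho m : Prop :=
  forall r : R, 0 < r ->
    low_singularity_density (m r) /\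
    {ae2, forall xy,
      (ereal_sup [set (rho a b xy.1 xy.2)%:E
                    | a in (`[- r, r]%classic%R : set R)
                    & b in (`[- r, r]%classic%R : set R)]
       <= (m r (enorm (subt xy.1 xy.2)))%:E)%E}.

Definition kernel_continuous rho : Prop :=
  {ae2, forall xy, continuous (fun ab : R * R => rho ab.1 ab.2 xy.1 xy.2)}.

Definition kernel_lipschitz rho m : Prop :=
  forall eps r : R, 0 < eps -> eps < r -> exists C : R, forall a b c d : R,
    - r <= a <= r -> - r <= b <= r -> - r <= c <= r -> - r <= d <= r ->
    eps <= `|a - b| -> eps <= `|c - d| ->
    {ae2, forall xy,
      `|rho a b xy.1 xy.2 - rho c d xy.1 xy.2| <=
      C * (`|a - c| + `|b - d|) * m r (enorm (subt xy.1 xy.2))}.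

(* The same family (m r) of majorants occurs in the bound and in the Lipschitz
   estimate. *)
Definition homogeneous_jump_kernel rho : Prop :=
  [/\ kernel_borel rho, kernel_symmetric rho, kernel_monotone rho,
      kernel_homogeneous rho &
      exists m : R -> R -> R,
        [/\ kernel_bounded rho m, kernel_continuous rho &
            kernel_lipschitz rho m]].

End jump_kernel.

Definition diff_quotient {R : realType} (Phi : R -> R) (a b : R) : R :=
  if a == b then lim ((fun z => Phi z / z) @ 0^') else Phi (a - b) / (a - b).

(* Main.v *)
Require Import Defs.
From mathcomp Require Import all_boot all_order all_algebra.
From mathcomp Require Import all_classical all_reals all_analysis.
From mathcomp Require Import measurable_realfun ring lra.

Set Implicit Arguments.
Unset Strict Implicit.
Unset Printing Implicit Defensive.

Import Order.TTheory GRing.Theory Num.Theory.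
Import numFieldNormedType.Exports.
Local Open Scope classical_set_scope.
Local Open Scope ring_scope.

(** The factor diff_quotient Phi a b depends only on z = a - b: it is q(z), where
    q(z) = Phi(z) / z is extended to z = 0 by its limit there ([quotient0]).
    Everything that concerns (a, b) is therefore a property of the single
    function q of one real variable.

    - q is continuous ([continuous_quotient0]), hence Borel in (a, b) and bounded
      on compact intervals; it is non-negative and even because Phi is odd and
      non-negative on the half-line. This gives nonnegativity, measurability,
      symmetry and continuity of the kernel.
    - z q(z) = Phi(z) ([mul_quotient0]), so that (a - b) F(a, b) = Phi(a - b) and
      the monotonicity axiom is the monotonicity of Phi.
    - For a, b in [-r, r] the difference a - b lies in [-2r, 2r], so that
      m_r = M_r mu is a majorant as soon as M_r bounds q on [-2r, 2r]; a constant
      multiple of mu is again a density with low singularity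
      ([low_singularity_densityZ]).
    - Away from the singularity of 1/z, q is Lipschitz on bounded sets
      ([quotient0_lipschitz]), because Phi, being locally Lipschitz, is Lipschitz
      on compact sets ([locally_lipschitz_compact]). Taking M_r >= 1 lets m_r
      serve also as the weight of the Lipschitz estimate, which naturally comes
      with mu in place of m_r.

    All the properties hold for every (x, y), not only almost everywhere. *)

(** * Functions that are locally Lipschitz *)

(** Local Lipschitz continuity, in the sense used here, controls f on a
    neighbourhood of each pair (x, y), including the pairs off the diagonal, so
    that compactness of K x K directly yields one constant. *)
Lemma locally_lipschitz_compact (R : numFieldType) (V W : normedModType R)
    (f : V -> W) (K : set V) :
  [locally [lipschitz f x | x in [set: V]]] -> compact K ->
  [lipschitz f x | x in K].
Proof.
move=> lipf cK; rewrite /lipschitz_on /dominated_by /globally /=.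
have /compact_near_coveringP coverK := compact_setX cK cK.
apply: (coverK R (pinfty_nbhs R) (fun k (p : V * V) =>
  `|f p.1 - f p.2| <= k * `|p.1 - p.2|) _) => p _.
have [M [realM lipM]] : lipschitz_on f (nbhs p).
  apply: sub_lipschitz (lipf p (conj I I)).
  by move=> A; apply: (@filterS _ _ (nbhs_filter p)) => q; apply.
have M1 : M < M + 1 by rewrite ltrDl.
(* One constant M + 1 works near p, and so does every larger one. *)
exists ([set q | `|f q.1 - f q.2| <= (M + 1) * `|q.1 - q.2|],
        [set k | M + 1 <= k]) => /=.
  split; first exact: lipM.
  by apply: nbhs_pinfty_ge; rewrite realD.
by move=> [q k] /= [/le_trans fq Mk]; apply/fq/ler_wpM2r.
Qed.

(** * The quotient Phi(z) / z *)

(** The function of one variable behind [diff_quotient]. *)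
Definition quotient0 (R : realType) (Phi : R -> R) (z : R) : R :=
  if z == 0 then lim ((fun z => Phi z / z) @ 0^') else Phi z / z.

Lemma diff_quotientE (R : realType) (Phi : R -> R) (a b : R) :
  diff_quotient Phi a b = quotient0 Phi (a - b).
Proof. by rewrite /diff_quotient /quotient0 subr_eq0. Qed.

Lemma odd_fun0 (R : realType) (Phi : R -> R) :
  (forall z, Phi (- z) = - Phi z) -> Phi 0 = 0.
Proof.
by move=> odd; have := odd 0; rewrite oppr0; lra.
Qed.

Lemma mul_quotient0 (R : realType) (Phi : R -> R) (z : R) :
  Phi 0 = 0 -> z * quotient0 Phi z = Phi z.
Proof.
move=> Phi0; rewrite /quotient0; have [->|z0] := eqVneq z 0.
  by rewrite mul0r Phi0.
by rewrite mulrC divfK.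
Qed.

Lemma quotient0N (R : realType) (Phi : R -> R) (z : R) :
  (forall z, Phi (- z) = - Phi z) -> quotient0 Phi (- z) = quotient0 Phi z.
Proof.
by move=> odd; rewrite /quotient0 oppr_eq0 odd invrN mulrNN.
Qed.

Lemma quotient0_ge0 (R : realType) (Phi : R -> R) (z : R) :
  (forall z, 0 <= z -> 0 <= Phi z) -> (forall z, Phi (- z) = - Phi z) ->
  cvg ((fun z => Phi z / z) @ 0^') -> 0 <= quotient0 Phi z.
Proof.
move=> Phi_ge0 odd limPhi.
have div_ge0 t : 0 <= Phi t / t.
  have [t0|t0] := leP 0 t; first by rewrite divr_ge0// Phi_ge0.
  rewrite -[t]opprK odd invrN mulrNN divr_ge0 ?Phi_ge0//; lra.
rewrite /quotient0; case: ifP => // _.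
by apply: limr_ge => //; apply: nearW.
Qed.

(** The value at 0 is chosen to make the singularity removable; elsewhere this is
    a quotient of continuous functions. *)
Lemma continuous_quotient0 (R : realType) (Phi : R -> R) :
  continuous Phi -> cvg ((fun z => Phi z / z) @ 0^') ->
  continuous (quotient0 Phi).
Proof.
move=> cPhi limPhi z.
have eqPhi t : t != 0 -> Phi t / t = quotient0 Phi t.
  by rewrite /quotient0 => /negbTE ->.
have [->|z0] := eqVneq z 0.
  apply/continuous_withinNx; rewrite {2}/quotient0 eqxx.
  apply: cvg_trans limPhi; apply: near_eq_cvg; near=> t.
  by apply: eqPhi; near: t; exact: nbhs_dnbhs_neq.
have : (fun z => Phi z / z) @ z --> quotient0 Phi z.
  by rewrite /quotient0 (negbTE z0); apply: cvgM; [exact: cPhi|exact: cvgV].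
apply: cvg_trans; apply: near_eq_cvg; near=> t.
by apply: eqPhi; near: t; exact: (cvgr_neq0 z cvg_id).
Unshelve. all: by end_near. Qed.

(** The bound is taken at least 1 so that it may also multiply from above a
    nonnegative quantity that has to be dominated. *)
Lemma continuous_bounded_itv (R : realType) (g : R -> R) (r : R) :
  continuous g -> exists2 M, 1 <= M & forall z, `|z| <= r -> g z <= M.
Proof.
move=> cg; have [r0|r0] := ltP r 0.
  by exists 1 => // z zr; have := normr_ge0 z; lra.
have [|c _ cmax] := @EVT_max R g (- r) r _ (continuous_subspaceT cg); first lra.
exists (Num.max 1 (g c)); first by rewrite le_max lexx.
by move=> z; rewrite ler_norml => zr; rewrite le_max cmax ?orbT// in_itv.
Qed.

(** On eps <= |z|, |w| <= r, write
      Phi(z)/z - Phi(w)/w = (Phi(z) - Phi(w))/z - Phi(w) (z - w)/(z w)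
    and use |1/z|, |1/w| <= 1/eps: a Lipschitz constant K and a bound B of Phi on
    [-r, r] give the constant K/eps + B/eps^2. The points z and w may lie on
    opposite sides of 0. *)
Lemma quotient0_lipschitz (R : realType) (Phi : R -> R) (eps r : R) :
  (forall z, Phi (- z) = - Phi z) ->
  continuous Phi -> [locally [lipschitz Phi z | z in [set: R]]] -> 0 < eps ->
  exists2 C, 0 <= C & forall z w, eps <= `|z| <= r -> eps <= `|w| <= r ->
    `|quotient0 Phi z - quotient0 Phi w| <= C * `|z - w|.
Proof.
move=> odd cPhi lipPhi eps0.
have /(locally_lipschitz_compact lipPhi) [K0 [_ lipK]] :=
  @segment_compact R (- r) r.
(* The constants known to work are those above K0, which may be negative. *)
pose K := Num.max K0 0 + 1.
have {}lipK z w : `|z| <= r -> `|w| <= r -> `|Phi z - Phi w| <= K * `|z - w|.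
  have KK0 : K0 < K by rewrite ltr_pwDr// le_max lexx.
  rewrite (ler_norml z) (ler_norml w) => zr wr; apply: (lipK K KK0 (z, w)).
  by split; rewrite /= in_itv.
have K_ge0 : 0 <= K by rewrite addr_ge0// le_max lexx orbT.
have [B B1 PhiB] := continuous_bounded_itv r cPhi.
have absPhi w : `|w| <= r -> `|Phi w| <= B.
  move=> wr; rewrite ler_norml PhiB// lerNl -odd PhiB ?normrN//.
have B0 : 0 <= B by lra.
exists (K / eps + B / eps ^+ 2).
  by rewrite addr_ge0// divr_ge0 ?exprn_ge0// ltW.
move=> z w /andP[ez zr] /andP[ew wr].
have nz : z != 0 by rewrite -normr_gt0; lra.
have nw : w != 0 by rewrite -normr_gt0; lra.
have Vle t : eps <= `|t| -> `|t^-1| <= eps^-1.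
  by move=> et; rewrite normfV lef_pV2// posrE; lra.
rewrite /quotient0 (negbTE nz) (negbTE nw).
have -> : Phi z / z - Phi w / w =
    (Phi z - Phi w) / z - Phi w * (z^-1 * w^-1) * (z - w) by field; rewrite ?nz ?nw.
apply: (le_trans (ler_normB _ _)); rewrite !normrM mulrDl; apply: lerD.
  rewrite mulrAC; apply: ler_pM => //; [exact: lipK|exact: Vle].
rewrite ler_wpM2r// ler_pM ?mulr_ge0 ?absPhi//.
by rewrite expr2 invfM ler_pM ?Vle.
Qed.

(** * Radial weights *)

Lemma enorm_ge0 (R : realType) (N : nat) (x : Rn R N) : 0 <= enorm x.
Proof. exact: sqrtr_ge0. Qed.

Lemma enorm_subtC (R : realType) (N : nat) (x y : Rn R N) :
  enorm (subt x y) = enorm (subt y x).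
Proof.
congr Num.sqrt; apply: eq_bigr => i _.
by rewrite !tnth_mktuple -sqrrN opprB.
Qed.

Lemma measurable_enorm (R : realType) (N : nat) :
  measurable_fun setT (@enorm R N).
Proof.
apply: (measurableT_comp (continuous_measurable_fun (@sqrt_continuous R))).
apply: measurable_sum => i; apply: measurable_funX; exact: measurable_tnth.
Qed.

Lemma measurable_subt (R : realType) (N : nat) :
  measurable_fun setT (fun p : Rn R N * Rn R N => subt p.1 p.2).
Proof.
apply/measurable_fun_tnthP => i.
rewrite (_ : _ \o _ = fun p : Rn R N * Rn R N =>
    (tnth p.1 i : R) - (tnth p.2 i : R)); last first.
  by apply/funext => p /=; rewrite tnth_mktuple.
by apply: measurable_funB; apply: (measurableT_comp (measurable_tnth i)).
Qed.

(** mu is only known to be measurable on the half-line, which contains the range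
    of the norm. *)
Lemma measurable_radial (R : realType) (N : nat) (mu : R -> R) :
  measurable_fun (`[0, +oo[%classic : set R) mu ->
  measurable_fun setT (fun y : Rn R N => mu (enorm y)).
Proof.
move=> mmu; apply: measurable_comp mmu (@measurable_enorm R N) => //.
by move=> _ [y _ <-]; rewrite /= in_itv /= enorm_ge0.
Qed.

Lemma low_singularity_densityZ (R : realType) (N : nat) (mu : R -> R) (k : R) :
  0 <= k -> low_singularity_density N mu ->
  low_singularity_density N (fun s => k * mu s).
Proof.
move=> k0 [mmu mu0 intmu]; split.
- exact: measurable_funM.
- by move=> s s0; rewrite mulr_ge0// mu0.
under eq_integral do rewrite mulrCA EFinM.
rewrite ge0_integralZl_EFin//.
- rewrite lte_mul_pinfty//.
- by move=> y _; rewrite lee_fin mulr_ge0 ?mu0 ?le_min ?ler01 ?enorm_ge0.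
- apply/measurable_EFinP; apply: measurable_funM; last exact: measurable_radial.
  by apply: measurable_minr => //; exact: measurable_enorm.
Qed.

(** * The kernel *)

Theorem proposition5p7 (R : realType) (N : nat) (Phi mu : R -> R)
  (Phi_cont : continuous Phi)
  (Phi_mono : {homo Phi : z w / z <= w})
  (Phi_ge0 : forall z, 0 <= z -> 0 <= Phi z)
  (Phi_odd : forall z, Phi (- z) = - Phi z)
  (Phi_lip : [locally [lipschitz Phi z | z in [set: R]]])
  (Phi_lim : cvg ((fun z => Phi z / z) @ 0^'))
  (mu_dens : low_singularity_density N mu) :
  homogeneous_jump_kernel
    (fun (a b : R) (x y : Rn R N) =>
       diff_quotient Phi a b * mu (enorm (subt x y))).
Proof.
have [mmu mu_ge0 _] := mu_dens.
have radial_ge0 (x y : Rn R N) : 0 <= mu (enorm (subt x y)).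
  exact/mu_ge0/enorm_ge0.
have q_ge0 z := quotient0_ge0 z Phi_ge0 Phi_odd Phi_lim.
have q_cont := continuous_quotient0 Phi_cont Phi_lim.
split.
- split=> [a b x y|]; first by rewrite diff_quotientE mulr_ge0.
  under eq_fun do rewrite diff_quotientE.
  apply: measurable_funM.
    apply: (measurableT_comp (continuous_measurable_fun q_cont)).
    by apply: measurable_funB; apply: measurableT_comp.
  apply: (measurableT_comp (measurable_radial mmu)).
  exact: (measurableT_comp (@measurable_subt R N)).
- move=> a b; apply: aeW => -[x y] /=.
  by rewrite !diff_quotientE enorm_subtC -(quotient0N (a - b))// opprB.
- move=> a b c d ca dc bd; apply: aeW => -[x y] /=.
  rewrite !diff_quotientE !mulrA !mul_quotient0 ?odd_fun0//.
  by rewrite ler_wpM2r// Phi_mono// lerB.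
- exists (fun a b s => diff_quotient Phi a b * mu s) => a b.
  exact: aeW.
(* |a - b| <= r + r when a and b are in [-r, r]. *)
have /choice[M M_spec] : forall r : R, exists M : R,
    1 <= M /\ forall z, `|z| <= r + r -> quotient0 Phi z <= M.
  by move=> r; have [M] := continuous_bounded_itv (r + r) q_cont; exists M.
have M1 r : 1 <= M r by have [] := M_spec r.
exists (fun r s => M r * mu s); split.
- move=> r r0; split.
    by apply: low_singularity_densityZ => //; have := M1 r; lra.
  apply: aeW => -[x y] /=; apply: ge_ereal_sup => _ /= [a ar [b br <-]].
  rewrite lee_fin diff_quotientE ler_wpM2r//.
  move: ar br; rewrite /= !in_itv /= -!ler_norml => ar br.
  have [_] := M_spec r; apply.
  exact: le_trans (ler_normB _ _) (lerD ar br).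
- apply: aeW => -[x y] /= ab.
  under eq_fun do rewrite diff_quotientE.
  apply: cvgM; last exact: cvg_cst.
  apply: (@continuous_comp _ _ _ (fun p : R * R => p.1 - p.2)).
    by apply: cvgB; [exact: cvg_fst|exact: cvg_snd].
  exact: q_cont.
- move=> eps r eps0 epsr.
  have [C C0 lipC] := quotient0_lipschitz (r + r) Phi_odd Phi_cont Phi_lip eps0.
  exists C => a b c d; rewrite -!ler_norml => ar br cr dr eab ecd.
  apply: aeW => -[x y] /=; rewrite !diff_quotientE -mulrBl normrM.
  rewrite (ger0_norm (radial_ge0 x y)) mulrA ler_wpM2r//.
  have sub_le u v : `|u| <= r -> `|v| <= r -> `|u - v| <= r + r.
    by move=> ur vr; exact: le_trans (ler_normB _ _) (lerD ur vr).
  apply: le_trans (lipC _ _ _ _) _; rewrite ?eab ?ecd ?sub_le//.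
  have -> : a - b - (c - d) = (a - c) - (b - d) by ring.
  apply: (@le_trans _ _ (C * (`|a - c| + `|b - d|))).
    by rewrite ler_wpM2l// ler_normB.
  (* The factor M r >= 1 turns the weight mu into m r. *)
  by rewrite ler_peMr// mulr_ge0 ?addr_ge0.
Qed.
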